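(* Let $X=\operatorname{Cay}(\Gamma,S)$ with base point $e$. Assume that, for every finite set $F\subset S_1(e)$, every coefficient choice $(\varepsilon_a)_{a\in F}$ with $|\varepsilon_a|\le1$, and all distinct $g,h\in\bigcup_{a\in F}\mathcal L^{\exists}_{\{a\}}$, the following identity holds for the multipliers $H^{\exists}=\sum_{a\in F}\varepsilon_aP_{\mathcal L^{\exists}_{\{a\}}}$ and $H^{\forall}=\sum_{a\in F}\varepsilon_aP_{\mathcal L^{\forall}_{\{a\}}}$: $$\begin{aligned}H^{\exists}(\lambda_g)(H^{\exists})^\circ(\lambda_{h^{-1}})&=H^{\forall}\big(\lambda_g(H^{\forall})^\circ(\lambda_{h^{-1}})\big)+(H^{\forall})^\circ\big(H^{\forall}(\lambda_g)\lambda_{h^{-1}}\big)-(H^{\forall})^\circ H^{\forall}(\lambda_g\lambda_{h^{-1}})\\&=H^{\forall}\big(\lambda_g(H^{\exists})^\circ(\lambda_{h^{-1}})\big)+(H^{\forall})^\circ\big(H^{\exists}(\lambda_g)\lambda_{h^{-1}}\big)-(H^{\forall})^\circ H^{\forall}(\lambda_g\lambda_{h^{-1}}).\end{aligned}$$ Then $X$ is a tree.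
   Context: $\Gamma$ is a discrete group generated by $S$, and its (connected) Cayley graph $X$ carries the path metric with every edge of length one; $\Gamma$ acts by left translation. $e$ is the identity and $S_1(e)$ is the set of points at distance $1$ from $e$. For $a\in X$, $\mathcal L^{\exists}_{\{a\}}=\{g\in\Gamma:\text{some geodesic from } e\text{ to }g\text{ passes through }a\}$ and $\mathcal L^{\forall}_{\{a\}}=\{g\in\Gamma:\text{every geodesic from } e\text{ to }g\text{ passes through }a\}$. $\lambda$ is the left regular representation of $\Gamma$; $P_{\mathcal E}$ (for $\mathcal E\subset\Gamma$) is the Fourier projection with $P_{\mathcal E}\lambda_g=\lambda_g$ if $g\in\mathcal E$ and $0$ otherwise; $\mathcal E^{-1}=\{g^{-1}:g\in\mathcal E\}$. The right-handed companions are $(H^{\exists})^\circ=\sum_{a\in F}\overline{\varepsilon_a}P_{(\mathcal L^{\exists}_{\{a\}})^{-1}}$ and $(H^{\forall})^\circ=\sum_{a\in F}\overline{\varepsilon_a}P_{(\mathcal L^{\forall}_{\{a\}})^{-1}}$. *)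

(* Defs.v *)
From HB Require Import structures.
From mathcomp Require Import all_boot all_order all_algebra.
From mathcomp Require Import ring lra complex.
From mathcomp Require Import finmap all_classical all_reals.
From mathcomp Require Import topology normedtype ereal esum.

Set Implicit Arguments.
Unset Strict Implicit.
Unset Printing Implicit Defensive.

Import Order.TTheory GRing.Theory Num.Theory.

Local Open Scope classical_set_scope.
Local Open Scope ring_scope.

Section Graph.
Variables (V : eqType) (adj : rel V).
Implicit Types (x y a : V) (p c : seq V) (n : nat).

(* [p] lists the vertices following [x], so [size p] is the number of edges. *)
Definition walk x y p : Prop := path adj x p /\ last x p = y.

(* The path metric, as a relation: d(x, y) = n. *)
Definition graph_dist x y n : Prop :=
  (exists2 p, walk x y p & size p = n) /\
  (forall q, walk x y q -> (n <= size q)%N).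

Definition sphere n x : set V := [set y | graph_dist x y n].

Definition geodesic x y p : Prop := walk x y p /\ graph_dist x y (size p).

Definition passes_through a x p : Prop := a \in x :: p.

Definition connected_graph : Prop := forall x y, exists p, walk x y p.

(* A cycle of size 2 only runs back and forth along an edge. *)
Definition acyclic : Prop := forall c, cycle adj c -> uniq c -> (size c <= 2)%N.

Definition is_tree : Prop := connected_graph /\ acyclic.

End Graph.

Section Cayley.
Variable G : groupType.
Implicit Types (S : set G) (a g h : G).

Definition generates S : Prop :=
  forall H : {pred G}, group_closed H -> (forall s, S s -> s \in H) ->
  forall g, g \in H.

(* Edges join g and g * s for s in S, so that left translations act by graph
   automorphisms.  S need not be symmetric, and the graph is simple: an element
   1 of S gives no loop, and an edge due to both s and s^-1 is not doubled. *)
Definition Cay S : rel G :=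
  fun g h => (g != h) && `[< S (g^-1 * h)%g \/ S (h^-1 * g)%g >].

Definition Lexists S a : set G :=
  [set g | exists2 p, geodesic (Cay S) 1%g g p & passes_through a 1%g p].

Definition Lforall S a : set G :=
  [set g | forall p, geodesic (Cay S) 1%g g p -> passes_through a 1%g p].

End Cayley.

Section Ell2.
Variables (R : realType) (G : groupType).
Local Notation normc := (@Normc.normc R).
Implicit Types (xi eta : G -> R[i]).

Definition square_summable xi : Prop :=
  summable [set: G] (fun k => ((normc (xi k)) ^+ 2)%:E).

Definition ell2_pred : {pred G -> R[i]} := [pred xi | `[< square_summable xi >]].

Let normc_ge0 (z : R[i]) : 0 <= normc z.
Proof. by case: z => a b; exact: sqrtr_ge0. Qed.

Let summable_le (u v : G -> R) : (forall k, 0 <= u k <= v k) ->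
  summable [set: G] (EFin \o v) -> summable [set: G] (EFin \o u).
Proof.
move=> uv; apply: le_lt_trans; apply: le_esum => k _ /=.
have /andP[u0 le_uv] := uv k.
by rewrite lee_fin !ger0_norm// (le_trans u0).
Qed.

Let summable_mulrn (u : G -> R) n : summable [set: G] (EFin \o u) ->
  summable [set: G] (fun k => (u k *+ n)%:E).
Proof.
move=> hu; elim: n => [|n IH].
  by rewrite /summable esum1 ?ltry// => k _; rewrite mulr0n abse0.
have := summableD hu IH; congr summable.
by apply/funext => k /=; rewrite mulrS EFinD.
Qed.

Lemma ell2_submod_closed : submod_closed ell2_pred.
Proof.
split.
  apply/asboolP; rewrite /square_summable /summable esum1 ?ltry// => k _.
  by rewrite [X in normc X](_ : _ = 0)// Normc.normc0 expr0n/= normr0.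
move=> a xi eta /asboolP hxi /asboolP heta; apply/asboolP.
have [n hn] : exists n : nat, (2 * (normc a) ^+ 2 <= n%:R)%R.
  exists (Num.bound (2 * (normc a) ^+ 2)).
  by rewrite ltW// archi_boundP// mulr_ge0// sqr_ge0.
have := summableD (summable_mulrn n hxi) (summable_mulrn 2 heta).
apply: (@summable_le _ (fun k => normc (xi k) ^+ 2 *+ n + normc (eta k) ^+ 2 *+ 2)) => k.
rewrite sqr_ge0/=.
rewrite -[(a *: xi + eta) k]/(a * xi k + eta k).
have := le_normcD (a * xi k) (eta k); rewrite Normc.normcM.
have := normc_ge0 (a * xi k + eta k).
set t := normc (_ + _); set u := normc a in hn *.
set v := normc (xi k); set w := normc (eta k) => t0 tle.
have tsq : t ^+ 2 <= (u * v + w) ^+ 2.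
  by rewrite ler_pXn2r// nnegrE (le_trans t0).
have : 2 * u ^+ 2 * v ^+ 2 <= n%:R * v ^+ 2 by rewrite ler_wpM2r// sqr_ge0.
have : 0 <= (u * v - w) ^+ 2 by exact: sqr_ge0.
rewrite -[v ^+ 2 *+ n]mulr_natl -[w ^+ 2 *+ 2]mulr_natl => h1 h2.
by apply: (le_trans tsq); nra.
Qed.

HB.instance Definition _ :=
  GRing.isSubmodClosed.Build R[i] (G -> R[i]) ell2_pred ell2_submod_closed.

Record ell2 : Type := Ell2 {
  ell2_val :> G -> R[i];
  ell2_valP : ell2_val \in ell2_pred
}.

HB.instance Definition _ := [isSub for ell2_val].
HB.instance Definition _ := [Choice of ell2 by <:].
HB.instance Definition _ := [SubChoice_isSubLmodule of ell2 by <:].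

Fact delta1_subproof : (fun k : G => (k == 1%g)%:R) \in ell2_pred.
Proof.
apply/asboolP; rewrite /square_summable /summable (esumID [set 1%g])//.
rewrite setTI esum_set1// setTI [X in (_ + X)%E]esum1 ?adde0 ?ltry// => k /eqP k1.
by rewrite (negbTE k1) Normc.normc0 expr0n/= normr0.
Qed.

Definition delta1 : ell2 := Ell2 delta1_subproof.

Fact lambda_subproof (g : G) (xi : ell2) :
  (fun k => xi (g^-1 * k)%g) \in ell2_pred.
Proof.
apply/asboolP; have /asboolP := valP xi.
rewrite /square_summable /summable.
rewrite (reindex_esum [set: G] [set: G] (fun k => g^-1 * k)%g)//.
split => //; first by move=> k l _ _; exact: mulgI.
by move=> k _; exists (g * k)%g => //; rewrite mulKg.
Qed.

(* Operators on l^2(G); their product is the composition [\o]. *)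
Local Notation op := (ell2 -> ell2).

(* lambda_g delta_k = delta_(g k) *)
Definition lambda (g : G) : op := fun xi : ell2 => Ell2 (lambda_subproof g xi).

(* The Fourier coefficient of T at g, i.e. <T delta_1, delta_g>. *)
Definition fourier_coef (T : op) (g : G) : R[i] := T delta1 g.

(* For T in the span of the lambda_g this is the restriction of the finite
   Fourier expansion of T to E (the sum ranges over the g in E at which the
   summand is nonzero; it is 0 if there are infinitely many). *)
Definition fourier_proj (E : set G) (T : op) : op :=
  \sum_(g \in E) fourier_coef T g *: lambda g.

Lemma fourier_coef_lambda g h : fourier_coef (lambda g) h = (h == g)%:R.
Proof.
rewrite /fourier_coef /lambda /=; congr (_%:R); congr nat_of_bool.
by apply/eqP/eqP => [/(congr1 (fun k => g * k)%g)|->]; rewrite ?mulVg// mulVKg mulg1.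
Qed.

Lemma fourier_coef_sum (s : seq G) (c : G -> R[i]) h :
  fourier_coef (\sum_(g <- s) c g *: lambda g) h =
  \sum_(g <- s) c g * (h == g)%:R.
Proof.
elim: s => [|g s IH]; first by rewrite !big_nil.
rewrite !big_cons -IH -fourier_coef_lambda /fourier_coef.
done.
Qed.

Lemma fourier_proj_sum (E : set G) (s : seq G) (c : G -> R[i]) : uniq s ->
  fourier_proj E (\sum_(g <- s) c g *: lambda g) =
  \sum_(g <- s | g \in E) c g *: lambda g.
Proof.
move=> us; rewrite /fourier_proj.
have coefE h : fourier_coef (\sum_(g <- s) c g *: lambda g) h =
    if h \in s then c h else 0.
  rewrite fourier_coef_sum; case: ifPn => hs.
    rewrite (big_rem h)//= eqxx mulr1 big_seq big1 ?addr0// => g.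
    by rewrite mem_rem_uniq// !inE eq_sym => /andP[/negbTE-> _]; rewrite mulr0.
  rewrite big_seq big1// => g gs; case: eqP => [hg|_]; last by rewrite mulr0.
  by rewrite hg gs in hs.
rewrite [RHS]big_mkcond/= [RHS]fsbig_seq// [LHS]fsbig_mkcond [RHS]fsbig_mkcond.
apply: eq_fsbigr => h _; rewrite /patch coefE mem_setE.
by case: (h \in s); rewrite ?scale0r//; case: ifP.
Qed.

Lemma fourier_proj_lambda (E : set G) g :
  fourier_proj E (lambda g) = if g \in E then lambda g else 0.
Proof.
have := @fourier_proj_sum E [:: g] (fun=> 1) isT.
rewrite big_seq1 scale1r => ->; rewrite big_mkcond big_seq1.
by case: ifP => _; rewrite ?scale1r.
Qed.

End Ell2.

Section Multipliers.
Variables (R : realType) (G : groupType).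
Local Notation op := (ell2 R G -> ell2 R G).
Implicit Types (F : {fset G}) (eps : G -> R[i]) (L : G -> set G).

(* H = sum_a eps_a P_(L a), acting on operators. *)
Definition multiplier F eps L (T : op) : op :=
  \sum_(a <- F) eps a *: fourier_proj (L a) T.

(* H^o = sum_a (eps_a)^* P_((L a)^-1). *)
Definition multiplier_circ F eps L (T : op) : op :=
  \sum_(a <- F) (eps a)^* *: fourier_proj [set g^-1%g | g in L a] T.

End Multipliers.

(* Main.v *)
Require Import Defs.
From mathcomp Require Import all_boot all_order all_algebra.
From mathcomp Require Import ring zify complex.
From mathcomp Require Import finmap all_classical all_reals.

(** Evaluated on [lambda], the identities become scalar identities between the
sums [c L g] of the [eps a] with [a] in [F] and [g] in [L a], where [k = g h^-1].

If [g] had two first steps [a <> b], then [h = a] and [F = {a}] force every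
geodesic to [k], but not every geodesic to [k^-1], to start with [a]; with
[F = {a, b}] and [eps = 1] the first identity then reads [2 = 1] or [2 = 0].
Hence first steps are unique.

If [x], [y] are adjacent and equally far from [1], take [g = x^-1] and
[h = y^-1], with first steps [a] and [b], so that [k = x^-1 y] and [k^-1] are
neighbours of [1] with [k <> a] and [k^-1 <> b].  The second right-hand side
gives [(eps a - c k) * conj (eps b - c k^-1) = 0] with [c = c Lforall], which fails when [eps a = 1] and
[eps = -1] elsewhere.  So adjacent vertices have distinct distances to [1], and
at a vertex of a cycle farthest from [1] both sides descend, which contradicts
the uniqueness of first steps. *)

Set Implicit Arguments.
Unset Strict Implicit.
Unset Printing Implicit Defensive.

Import Order.TTheory GRing.Theory Num.Theory.

Local Open Scope classical_set_scope.

(** * Path metric and geodesics in a connected graph *)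

Section GraphDistance.
Variables (V : eqType) (adj : rel V).
Implicit Types (x y z a b : V) (p q : seq V).

(** At most one number satisfies the relation; the default 0 is the value for pairs joined by no
    walk, which connectedness excludes. *)
Definition dist x y : nat := xget 0%N (graph_dist adj x y).

Lemma walk_cat x y z p q :
  walk adj x y p -> walk adj y z q -> walk adj x z (p ++ q).
Proof.
move=> [xp yp] [yq zq]; split; first by rewrite cat_path xp yp.
by rewrite last_cat yp.
Qed.

Lemma walk_rev x y p : symmetric adj -> walk adj x y p ->
  exists2 q, walk adj y x q & size q = size p.
Proof.
move=> adjC [xp yp]; exists (rev (belast x p)); last by rewrite size_rev size_belast.
split; first by rewrite -yp rev_path (eq_path (fun u v => adjC v u)).
case: p xp yp => [|z p] /= _ yp; first by rewrite yp.
by rewrite rev_cons last_rcons.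
Qed.

Hypothesis conn : connected_graph adj.

Lemma distP x y : graph_dist adj x y (dist x y).
Proof.
apply: (xgetPex 0%N); have [p wp] := conn x y.
pose P n := `[< exists2 p, walk adj x y p & size p = n >].
have exP : exists n, P n by exists (size p); apply/asboolP; exists p.
have [n /asboolP Pn minn] := ex_minnP exP; exists n; split => // q wq.
by apply: minn; apply/asboolP; exists q.
Qed.

Lemma dist_le x y p : walk adj x y p -> (dist x y <= size p)%N.
Proof. by move=> wp; apply: (distP x y).2. Qed.

Lemma graph_distE x y n : graph_dist adj x y n -> n = dist x y.
Proof.
move=> [[p wp <-] minp]; apply/eqP; rewrite eqn_leq dist_le// andbT.
by have [[q wq <-] _] := distP x y; exact: minp.
Qed.

Lemma geodesic_exists x y : exists2 p, geodesic adj x y p & size p = dist x y.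
Proof.
have [[p wp sp] _] := distP x y; exists p => //; split => //.
by rewrite sp; exact: distP.
Qed.

Lemma geodesic_size x y p : geodesic adj x y p -> size p = dist x y.
Proof. by move=> [_ /graph_distE]. Qed.

Lemma walk_geodesic x y p :
  walk adj x y p -> (size p <= dist x y)%N -> geodesic adj x y p.
Proof.
move=> wp le_p; split => //; have <- : dist x y = size p; last exact: distP.
by apply/eqP; rewrite eqn_leq dist_le.
Qed.

Lemma dist_triangle x y z : (dist x z <= dist x y + dist y z)%N.
Proof.
have [p [wp _] <-] := geodesic_exists x y; have [q [wq _] <-] := geodesic_exists y z.
by rewrite -size_cat dist_le//; exact: walk_cat wp wq.
Qed.

Lemma dist_eq0 x y : (dist x y == 0%N) = (x == y).
Proof.
apply/idP/eqP => [/eqP d0|<-]; last by rewrite -leqn0; apply: (dist_le (p := [::])).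
by have [[|b p] [[_ /= yx] _]] := geodesic_exists x y; rewrite d0.
Qed.

Lemma adj_walk x y : adj x y -> walk adj x y [:: y].
Proof. by move=> xy; split; rewrite /= ?xy. Qed.

Lemma dist_adj x y : irreflexive adj -> adj x y -> dist x y = 1%N.
Proof.
move=> adjxx xy; apply/eqP; rewrite eqn_leq (dist_le (adj_walk xy)) lt0n dist_eq0.
by apply: contraTneq xy => <-; rewrite adjxx.
Qed.

Lemma adj_sphere1 x a : irreflexive adj -> adj x a -> sphere adj 1 x a.
Proof. by move=> adjxx xa; rewrite -(dist_adj adjxx xa); exact: distP. Qed.

(** If [a] came later on [p], the edge from [x] to [a] followed by the rest of [p] after [a] would
    be a shorter walk. *)
Lemma geodesic_through_adj x y a p : irreflexive adj -> adj x a ->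
  geodesic adj x y p -> passes_through a x p -> exists p', p = a :: p'.
Proof.
move=> adjxx xa gp; rewrite /passes_through inE.
have -> /= : (a == x) = false by apply: contraTF xa => /eqP->; rewrite adjxx.
move=> ap; case/splitPr: ap gp => p1 p2 gp.
have [[]] := gp; rewrite cat_path last_cat /= => /and3P[_ _ ap2] yp2 _.
have /dist_le : walk adj x y (a :: p2) by split; rewrite /= ?xa.
by rewrite -(geodesic_size gp); case: p1 gp => [|b p1] gp; [exists p2|rewrite size_cat/=; lia].
Qed.

Lemma dist_geodesic_cons x y a p :
  geodesic adj x y (a :: p) -> dist x y = (dist a y).+1.
Proof.
move=> gp; have [[/= /andP[xa wp] yp] _] := gp.
have wap : walk adj a y p by split.
apply/eqP; rewrite eqn_leq -{2}(geodesic_size gp) ltnS dist_le// andbT.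
have [q [[aq yq] _] <-] := geodesic_exists a y.
by apply: (@dist_le x y (a :: q)); split; rewrite /= ?xa.
Qed.

End GraphDistance.

(** * Geodesics in the Cayley graph under left translation *)

Section CayleyGraph.
Variables (G : groupType) (S : set G).
Implicit Types (a b g h x y z : G).

Lemma Cay_irr : irreflexive (Cay S).
Proof. by move=> x; rewrite /Cay eqxx. Qed.

Lemma Cay_sym : symmetric (Cay S).
Proof. by move=> x y; rewrite /Cay eq_sym; congr andb; apply: asbool_equiv_eq; tauto. Qed.

Lemma Cay_translate z x y : Cay S (z * x)%g (z * y)%g = Cay S x y.
Proof.
by rewrite /Cay (inj_eq (@mulgI _ z)) !invgM -!mulgA !mulKg.
Qed.

Lemma Cay1 x y : Cay S 1%g (x^-1 * y)%g = Cay S x y.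
Proof. by rewrite -(Cay_translate x) mulg1 mulVKg. Qed.

Lemma walk_translate z x y p : walk (Cay S) x y p ->
  walk (Cay S) (z * x)%g (z * y)%g [seq (z * u)%g | u <- p].
Proof.
move=> [xp <-]; split; last by rewrite last_map.
by rewrite path_map (eq_path (Cay_translate z)).
Qed.

Lemma Cay_connected : generates S -> connected_graph (Cay S).
Proof.
move=> genS.
suff conn1 g : exists p, walk (Cay S) 1%g g p.
  move=> x y; have [p /(walk_translate x)] := conn1 (x^-1 * y)%g.
  by rewrite mulg1 mulVKg; eexists; eassumption.
pose H : {pred G} := [pred g | `[< exists p, walk (Cay S) 1%g g p >]].
suff : g \in H by move/asboolP.
apply: genS g => [|s Ss].
  split; first by apply/asboolP; exists [::].
  move=> x y /asboolP[p wp] /asboolP[q wq]; apply/asboolP.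
  have [r wr _] := walk_rev Cay_sym wq.
  (* Translation by [x * y^-1] takes the reversed walk from [y] to 1 to a walk from [x] to
     [x * y^-1]. *)
  have := walk_translate (x * y^-1)%g wr; rewrite mulgVK mulg1 => /(walk_cat wp).
  by eexists; eassumption.
apply/asboolP; have [->|s1] := eqVneq s 1%g; first by exists [::].
exists [:: s]; apply: adj_walk; rewrite /Cay eq_sym s1.
by apply/asboolP; left; rewrite invg1 mul1g.
Qed.

Hypothesis conn : connected_graph (Cay S).
Local Notation d := (dist (Cay S)).

Lemma dist_translate z x y : d (z * x)%g (z * y)%g = d x y.
Proof.
have le u v w : (d (w * u)%g (w * v)%g <= d u v)%N.
  have [p [wp _] <-] := geodesic_exists conn u v.
  by rewrite -(size_map (fun t => w * t)%g p) dist_le//; exact: walk_translate.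
by apply/eqP; rewrite eqn_leq le/= -{1}(mulKg z x) -{1}(mulKg z y) le.
Qed.

(** Prefixing the edge from 1 to [a] to a shortest walk from [a] yields a geodesic exactly when the
    lengths match. *)
Lemma LexistsP a g : Cay S 1%g a -> Lexists S a g <-> d 1%g g = (d a g).+1.
Proof.
move=> a1; split=> [[p gp /(geodesic_through_adj conn Cay_irr a1 gp)[q qE]]|dE].
  by rewrite qE in gp; exact: dist_geodesic_cons gp.
have [p [[ap gp] _] sp] := geodesic_exists conn a g.
exists (a :: p); last by rewrite /passes_through !inE eqxx orbT.
by apply: walk_geodesic => //=; [split; rewrite //= a1|rewrite dE sp].
Qed.

(** Translation by [x^-1] turns a descent towards 1 along the edge from [x] to [y] into a first step
    from 1 towards [x^-1]. *)
Lemma LexistsV x y : Cay S x y ->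
  Lexists S (x^-1 * y)%g x^-1%g <-> d x 1%g = (d y 1%g).+1.
Proof.
move=> xy; rewrite -(dist_translate x^-1 x) -(dist_translate x^-1 y) mulVg mulg1.
by apply: LexistsP; rewrite Cay1.
Qed.

Lemma first_step_exists g : g != 1%g -> exists2 a, Cay S 1%g a & Lexists S a g.
Proof.
move=> g1; have [[|a p] gp _] := geodesic_exists conn 1%g g.
  by case: gp => -[_ /= g0]; rewrite g0 eqxx in g1.
exists a; last by exists (a :: p); rewrite // /passes_through !inE eqxx orbT.
by case: gp => -[/= /andP[]].
Qed.

Lemma Lforall_Lexists a g : Lforall S a g -> Lexists S a g.
Proof.
by have [p gp _] := geodesic_exists conn 1%g g => La; exists p => //; exact: La.
Qed.

Lemma Lforall_inj a b g : Cay S 1%g a -> Cay S 1%g b ->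
  Lforall S a g -> Lexists S b g -> a = b.
Proof.
move=> a1 b1 La [p gp /(geodesic_through_adj conn Cay_irr b1 gp)[q qE]].
have [r] := geodesic_through_adj conn Cay_irr a1 gp (La p gp).
by rewrite qE => -[].
Qed.

Lemma Lforall_self a : Lforall S a a.
Proof. by move=> p [[_ lastE] _]; rewrite /passes_through -{1}lastE mem_last. Qed.

Lemma Lforall_sphere1 a b : Cay S 1%g a -> Lforall S b a -> Cay S 1%g b -> b = a.
Proof.
move=> a1 Lb b1; apply: (Lforall_inj b1 a1 Lb).
exact/Lforall_Lexists/Lforall_self.
Qed.

Lemma Cay_acyclic :
  (forall a b g, Cay S 1%g a -> Cay S 1%g b ->
     Lexists S a g -> Lexists S b g -> a = b) ->
  (forall x y, Cay S x y -> d x 1%g <> d y 1%g) ->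
  acyclic (Cay S).
Proof.
move=> uniq_step bip c cyc uc; rewrite leqNgt; apply/negP => c3.
have [v vc vmax] : exists2 v, v \in c & forall w, w \in c -> (d w 1%g <= d v 1%g)%N.
  case: c c3 {cyc uc} => // x c _; elim: c x => [|y c IH] x.
    by exists x; rewrite ?inE// => w; rewrite inE => /eqP->.
  have [v vc vmax] := IH y.
  have [le_xv|lt_vx] := leqP (d x 1%g) (d v 1%g).
    exists v; first by rewrite inE vc orbT.
    by move=> w; rewrite inE => /predU1P[->|/vmax].
  exists x; first by rewrite mem_head.
  move=> w; rewrite inE => /predU1P[->//|/vmax /leq_trans]; apply; exact: ltnW.
have [i s rotE] := rot_to vc.
have cE : c =i v :: s by move=> w; rewrite -rotE mem_rot.
rewrite -(size_rot i) rotE in c3; rewrite -(rot_uniq i) rotE in uc.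
rewrite -(rot_cycle i) rotE in cyc.
(* The rotated cycle reads [v], [y], [s], [x], so [y] and [x] are the neighbours of [v] on it;
   length at least 3 keeps them apart. *)
case/lastP: s => [//|[//|y s] x] in rotE cE c3 uc cyc *.
have vstep w : w \in c -> Cay S v w -> Lexists S (v^-1 * w)%g v^-1%g.
  move=> wc vw; apply/(LexistsV vw).
  (* The distance drops from [v] to [w] by at most 1, does not grow since [v] is farthest, and is
     not constant by [bip]: it drops by exactly 1. *)
  have := bip _ _ vw; have := vmax _ wc; have := dist_triangle conn v w 1%g.
  by rewrite (dist_adj conn Cay_irr vw); lia.
have yc : y \in c by rewrite cE !inE eqxx orbT.
have xc : x \in c by rewrite cE !inE mem_rcons mem_head !orbT.
move: cyc; rewrite /= !rcons_path !last_rcons => /and3P[vy _ xv].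
have vx : Cay S v x by rewrite Cay_sym.
have /mulgI xy : (v^-1 * x = v^-1 * y)%g.
  by apply: uniq_step (vstep _ xc vx) (vstep _ yc vy); rewrite Cay1.
by move: uc; rewrite xy /= mem_rcons inE eqxx andbF.
Qed.

End CayleyGraph.

Local Open Scope ring_scope.

(** * Reduction of the operator identities to scalar ones *)

Section MultiplierCoefficients.
Variables (R : realType) (G : groupType).
Local Notation op := (ell2 R G -> ell2 R G).
Implicit Types (g h k : G) (z w : R[i]) (F : {fset G}) (eps : G -> R[i])
  (L M : G -> set G).

Lemma fourier_projZ (E : set G) z g :
  fourier_proj E (z *: @lambda R G g) = (if g \in E then z else 0) *: @lambda R G g.
Proof.
have := @fourier_proj_sum R G E [:: g] (fun=> z) isT.
rewrite big_seq1 => ->; rewrite big_mkcond big_seq1.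
by case: ifP; rewrite ?scale0r.
Qed.

Lemma scale_lambda_inj g : injective (fun z => z *: (@lambda R G g : op)).
Proof.
move=> z w /(congr1 (fun T : op => fourier_coef T g)).
have coefE t : fourier_coef (t *: (@lambda R G g : op)) g = t * fourier_coef (@lambda R G g) g.
  by [].
by rewrite !coefE fourier_coef_lambda eqxx !mulr1.
Qed.

Lemma lambdaM z w g h :
  (z *: (@lambda R G g : op)) \o (w *: (@lambda R G h : op)) =
  (z * w) *: (@lambda R G (g * h)%g : op).
Proof.
apply/funext => xi; apply/val_inj/funext => k.
rewrite -[LHS]/(z * (w * xi (h^-1 * (g^-1 * k))%g)) -[RHS]/(z * w * xi ((g * h)^-1 * k)%g).
by rewrite mulrA invgM mulgA.
Qed.

(** The eigenvalue of the multiplier on [lambda g]. *)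
Definition multiplier_coef F eps L g : R[i] := \sum_(a <- F | g \in L a) eps a.

Lemma multiplier_coef0 F eps L g :
  (forall a, a \in F -> ~ L a g) -> multiplier_coef F eps L g = 0.
Proof.
move=> notL; rewrite /multiplier_coef big_seq_cond big1// => a /andP[aF /set_mem].
by move/(notL a aF).
Qed.

Lemma multiplier_coef1 F eps L g a : a \in F -> L a g ->
  (forall b, b \in F -> L b g -> b = a) -> multiplier_coef F eps L g = eps a.
Proof.
move=> aF La uniqa; rewrite /multiplier_coef big_mkcond (big_rem a)//= mem_set//.
rewrite big_seq big1 ?addr0// => b; rewrite mem_rem_uniq ?fset_uniq// !inE.
by case: ifPn => // /set_mem Lb /andP[/eqP + bF]; case; exact: uniqa.
Qed.

Lemma multiplierZ F eps L z g :
  multiplier F eps L (z *: @lambda R G g) =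
  (multiplier_coef F eps L g * z) *: @lambda R G g.
Proof.
rewrite /multiplier /multiplier_coef mulr_suml scaler_suml.
rewrite [RHS]big_mkcond; apply: eq_bigr => a _.
rewrite fourier_projZ; case: ifP => _; first by rewrite scalerA.
by rewrite scale0r scaler0.
Qed.

(** Inverting the sets moves the eigenvalue to [g^-1], and conjugating [eps] conjugates it. *)
Lemma multiplier_circZ F eps L z g :
  multiplier_circ F eps L (z *: @lambda R G g) =
  ((multiplier_coef F eps L g^-1%g)^* * z) *: @lambda R G g.
Proof.
rewrite /multiplier_circ /multiplier_coef rmorph_sum mulr_suml scaler_suml.
rewrite [RHS]big_mkcond; apply: eq_bigr => a _.
rewrite fourier_projZ.
have -> : (g \in [set h^-1%g | h in L a]) = (g^-1%g \in L a).
  apply/idP/idP => [/set_mem[h Lh <-]|/set_mem Lg]; apply/mem_set.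
    by rewrite invgK.
  by exists g^-1%g; rewrite ?invgK.
by case: ifP => _; [rewrite scalerA|rewrite scale0r scaler0].
Qed.

(** All terms are multiples of [lambda k], so their scalars can be compared. Leaving [N] free covers
    both right-hand sides, which differ only in the multipliers applied before taking the
    product. *)
Lemma cotlar_coefE F eps L M N g h (k := (g * h^-1)%g) :
  let lam := @lambda R G in
  let c := multiplier_coef F eps in
  multiplier F eps L (lam g) \o multiplier_circ F eps L (lam h^-1%g) =
    multiplier F eps M (lam g \o multiplier_circ F eps N (lam h^-1%g))
    + multiplier_circ F eps M (multiplier F eps N (lam g) \o lam h^-1%g)
    - multiplier_circ F eps M (multiplier F eps M (lam g \o lam h^-1%g)) ->
  c L g * (c L h)^* =
    c M k * (c N h)^* + (c M k^-1%g)^* * c N g - (c M k^-1%g)^* * c M k.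
Proof.
move=> lam c; rewrite /lam -[lambda g]scale1r -[lambda h^-1%g]scale1r.
rewrite !(multiplierZ, multiplier_circZ, lambdaM) invgK !mulr1 !mul1r.
by rewrite -scalerDl -scalerBl => /scale_lambda_inj.
Qed.

End MultiplierCoefficients.

(** * Unique first steps, and no edge between equidistant vertices *)

Section CotlarIdentities.
Variables (R : realType) (G : groupType) (S : set G).
Implicit Types (a b g h k s x y : G) (F : {fset G}) (eps : G -> R[i]).

Hypothesis conn : connected_graph (Cay S).

Local Notation cexists F eps := (multiplier_coef F eps (Lexists S)).
Local Notation cforall F eps := (multiplier_coef F eps (Lforall S)).

(** The scalar form of the assumed identities: [L = Lforall S] is the first right-hand side,
    [L = Lexists S] the second. *)
Hypothesis cotlar : forall F eps L g h (k := (g * h^-1)%g),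
  (forall a, a \in F -> Cay S 1%g a) -> (forall a, a \in F -> `|eps a| <= 1) ->
  g != h -> (exists2 a, a \in F & Lexists S a g) ->
  (exists2 a, a \in F & Lexists S a h) -> L = Lforall S \/ L = Lexists S ->
  cexists F eps g * (cexists F eps h)^* =
  cforall F eps k * (multiplier_coef F eps L h)^*
  + (cforall F eps k^-1%g)^* * multiplier_coef F eps L g
  - (cforall F eps k^-1%g)^* * cforall F eps k.

(** When one first step is forced no other is possible, so the sum has a single term. *)
Lemma cforallE F eps a g : (forall b, b \in F -> Cay S 1%g b) -> a \in F ->
  Lforall S a g -> cforall F eps g = eps a.
Proof.
move=> adjF aF Lag; apply: multiplier_coef1 => // b bF /Lforall_Lexists Lbg.
by apply/esym/(Lforall_inj conn _ _ Lag); [exact: adjF..|exact: Lbg].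
Qed.

Lemma cforall_sphere1 F eps s : (forall b, b \in F -> Cay S 1%g b) ->
  Cay S 1%g s -> cforall F eps s = if s \in F then eps s else 0.
Proof.
move=> adjF s1; case: ifPn => [sF|snF].
  by apply: cforallE => //; exact: Lforall_self.
apply: multiplier_coef0 => b bF /(Lforall_sphere1 conn s1)/(_ (adjF b bF)) bs.
by rewrite -bs bF in snF.
Qed.

Lemma unique_first_step a b g : Cay S 1%g a -> Cay S 1%g b ->
  Lexists S a g -> Lexists S b g -> a = b.
Proof.
move=> a1 b1 Lag Lbg; apply/eqP/negPn/negP => /eqP ab.
(* With all coefficients 1, [cexists] counts the possible first steps in [F], and [cforall] is 1 or
   0 according to whether one of them is forced. *)
pose e1 : G -> R[i] := fun=> 1.
have e1_le F x : x \in F -> `|e1 x| <= 1 by rewrite normr1.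
have Laa : Lforall S a a by exact: Lforall_self.
have notLba : ~ Lexists S b a by move/(Lforall_inj conn a1 b1 Laa).
have notLag : ~ Lforall S a g.
  by move=> /(Lforall_inj conn a1 b1)/(_ Lbg).
have notLbg : ~ Lforall S b g.
  by move=> /(Lforall_inj conn b1 a1)/(_ Lag)/esym.
have ga : g != a by apply: contra_notN notLag => /eqP->.
set k := (g * a^-1)%g.
have LaaE := Lforall_Lexists conn Laa.
have adj1 x : x \in [fset a]%fset -> Cay S 1%g x by move/fset1P->.
have adj2 x : x \in [fset a; b]%fset -> Cay S 1%g x by case/fset2P => ->.
(* Write [c] for [cforall]. Since [c a = 1] and [c g = 0], the identity on [F = {a}] reads
   [1 = c k - conj (c k^-1) * c k], hence [c k = 1] and [c k^-1 = 0]. *)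
have [Lak notLak'] : Lforall S a k /\ ~ Lforall S a k^-1%g.
  have aF : a \in [fset a]%fset by rewrite inE.
  have := cotlar adj1 (@e1_le _) ga (ex_intro2 _ (fun x => Lexists S x g) a aF Lag)
    (ex_intro2 _ (fun x => Lexists S x a) a aF LaaE) (or_introl erefl).
  rewrite -/k !(@multiplier_coef1 _ _ _ e1 (Lexists S) _ a)//; first last.
  - by move=> x /fset1P.
  - by move=> x /fset1P.
  rewrite (@cforallE _ _ a a)// (@multiplier_coef0 _ _ _ _ _ g); last first.
    by move=> x /fset1P->.
  rewrite rmorph1 !mulr1 mulr0 addr0.
  have [Lak|notLak] := pselect (Lforall S a k); last first.
    rewrite (@multiplier_coef0 _ _ _ _ _ k) ?mulr0 ?subr0; last by move=> x /fset1P->.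
    by move/eqP; rewrite oner_eq0.
  move=> cE; split=> // Lak'; move/eqP: cE; rewrite !(@cforallE _ _ a)//.
  by rewrite rmorph1 mulr1 subrr oner_eq0.
have aF : a \in [fset a; b]%fset by rewrite !inE eqxx.
have bF : b \in [fset a; b]%fset by rewrite !inE eqxx orbT.
(* Adding [b] to [F] raises the left side to 2, while the right side becomes [1 - conj (c k^-1)],
   where only [b] can still be forced for [k^-1]. *)
have := cotlar adj2 (@e1_le _) ga (ex_intro2 _ (fun x => Lexists S x g) a aF Lag)
  (ex_intro2 _ (fun x => Lexists S x a) a aF LaaE) (or_introl erefl).
have -> : cexists [fset a; b]%fset e1 g = 2.
  rewrite /multiplier_coef big_mkcond big_fsetU1 ?inE; last exact/eqP.
  by rewrite big_seq_fset1 !mem_set.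
rewrite -/k (@multiplier_coef1 _ _ _ e1 (Lexists S) _ a)//; last first.
  by move=> x /fset2P[->//|->] /notLba.
rewrite (@cforallE _ _ a a)// (@cforallE _ _ a k)// (@multiplier_coef0 _ _ _ _ _ g); last first.
  by move=> x /fset2P[]->.
rewrite rmorph1 !mulr1 mulr0 addr0.
have [Lbk'|notLbk'] := pselect (Lforall S b k^-1%g).
  rewrite (@cforallE _ _ b)// rmorph1 subrr => /eqP.
  by rewrite pnatr_eq0.
rewrite multiplier_coef0 ?rmorph0 ?subr0; last by move=> x /fset2P[]->.
by move/eqP; rewrite -[X in _ == X]/(1%:R) eqr_nat.
Qed.

Lemma adj_dist_neq x y : Cay S x y -> dist (Cay S) x 1%g <> dist (Cay S) y 1%g.
Proof.
move=> xy dxy.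
have yx : Cay S y x by rewrite Cay_sym.
have x1 : x != 1%g.
  apply: contraTneq xy => x1; have := dist_eq0 conn y 1%g.
  by rewrite -dxy (dist_eq0 conn) x1 eqxx => /esym/eqP->; rewrite Cay_irr.
have y1 : y != 1%g.
  apply: contraTneq xy => y1; have := dist_eq0 conn x 1%g.
  by rewrite dxy (dist_eq0 conn) y1 eqxx => /esym/eqP->; rewrite Cay_irr.
have [|a a1 Lax] := @first_step_exists _ _ conn x^-1%g; first by rewrite invg_eq1.
have [|b b1 Lby] := @first_step_exists _ _ conn y^-1%g; first by rewrite invg_eq1.
set s := (x^-1 * y)%g.
(* If [s = a], the edge from [x] to [y] would descend towards 1, against the equal distances;
   likewise for [s^-1 = b] and the edge from [y] to [x]. *)
have sa : s != a.
  by apply/eqP => sa; move: Lax; rewrite -sa => /(LexistsV conn xy); rewrite dxy; lia.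
have sb : s^-1%g != b.
  rewrite invgM invgK; apply/eqP => sb.
  by move: Lby; rewrite -sb => /(LexistsV conn yx); rewrite dxy; lia.
pose F := [fset a; b]%fset.
have aF : a \in F by rewrite !inE eqxx.
have bF : b \in F by rewrite !inE eqxx orbT.
have adjF z : z \in F -> Cay S 1%g z by case/fset2P => ->.
pose eps z : R[i] := if z == a then 1 else - 1.
have eps_le z : z \in F -> `|eps z| <= 1.
  by rewrite /eps; case: ifP; rewrite ?normrN normr1.
(* Uniqueness of first steps leaves one term even in the existential sums. *)
have cexistsE z g : z \in F -> Lexists S z g -> cexists F eps g = eps z.
  move=> zF Lzg; apply: multiplier_coef1 => // w wF Lwg.
  by apply: unique_first_step Lwg Lzg; exact: adjF.
have gh : x^-1%g != y^-1%g.
  by rewrite (inj_eq invg_inj); apply: contraTneq xy => ->; rewrite Cay_irr.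
have := cotlar adjF eps_le gh (ex_intro2 _ (fun z => Lexists S z _) a aF Lax)
  (ex_intro2 _ (fun z => Lexists S z _) b bF Lby) (or_intror erefl).
rewrite invgK -/s !(cexistsE _ _ aF Lax) !(cexistsE _ _ bF Lby).
rewrite !cforall_sphere1 //; last 2 first.
- by rewrite /s invgM invgK Cay1.
- by rewrite /s Cay1.
rewrite [eps a]/eps eqxx => /eqP; rewrite -subr_eq0.
set es := if s \in F then _ else _; set es' := if s^-1%g \in F then _ else _.
(* With [L = Lexists S] the difference of the two sides factors; [es] and [es'] are the values of
   [cforall] at [s] and [s^-1]. *)
rewrite (_ : _ - _ = (1 - es) * (eps b - es')^*); last by rewrite rmorphB; ring.
have N11 : (-1 : R[i]) != 1 by rewrite lt_eqF// (lt_trans (ltrN10 _) ltr01).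
(* As [s] is not [a], [es] is 0 or -1, never 1. As [s^-1] is not [b], either [es' = 0], while
   [eps b] is a sign, or [s^-1 = a], and then [es' = 1] while [eps b = -1]. *)
rewrite mulf_eq0 conjC_eq0 !subr_eq0 => /orP[].
  rewrite eq_sym /es /eps (negbTE sa); case: ifP => _; first by rewrite (negbTE N11).
  by rewrite eq_sym oner_eq0.
rewrite /es'; case: ifPn => [/fset2P[sa'|/eqP]|_]; last 2 first.
- by rewrite (negbTE sb).
- by rewrite /eps; case: ifP => _; rewrite ?oppr_eq0 oner_eq0.
by rewrite /eps sa' eqxx (eq_sym b) -sa' (negbTE sb) (negbTE N11).
Qed.

End CotlarIdentities.

(** * The tree property from the operator identities *)

Theorem proposition4p2 (R : realType) (G : groupType) (S : set G)
    (hS : generates S)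
    (hcotlar : forall (F : {fset G}) (eps : G -> R[i]),
      [set` F] `<=` sphere (Cay S) 1 1%g ->
      (forall a, a \in F -> `|eps a| <= 1) ->
      forall g h : G, g != h ->
      (\bigcup_(a in [set` F]) Lexists S a) g ->
      (\bigcup_(a in [set` F]) Lexists S a) h ->
      let lam := @lambda R G in
      let He := multiplier F eps (Lexists S) in
      let Hec := multiplier_circ F eps (Lexists S) in
      let Ha := multiplier F eps (Lforall S) in
      let Hac := multiplier_circ F eps (Lforall S) in
      He (lam g) \o Hec (lam h^-1%g) =
        Ha (lam g \o Hac (lam h^-1%g)) + Hac (Ha (lam g) \o lam h^-1%g)
          - Hac (Ha (lam g \o lam h^-1%g)) /\
      Ha (lam g \o Hac (lam h^-1%g)) + Hac (Ha (lam g) \o lam h^-1%g)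
          - Hac (Ha (lam g \o lam h^-1%g)) =
        Ha (lam g \o Hec (lam h^-1%g)) + Hac (He (lam g) \o lam h^-1%g)
          - Hac (Ha (lam g \o lam h^-1%g))) :
  is_tree (Cay S).
Proof.
have conn := Cay_connected hS.
have cotlar (F : {fset G}) (eps : G -> R[i]) L g h (k := (g * h^-1)%g) :
    (forall a, a \in F -> Cay S 1%g a) ->
    (forall a, a \in F -> `|eps a| <= 1) -> g != h ->
    (exists2 a, a \in F & Lexists S a g) -> (exists2 a, a \in F & Lexists S a h) ->
    L = Lforall S \/ L = Lexists S ->
    multiplier_coef F eps (Lexists S) g * (multiplier_coef F eps (Lexists S) h)^* =
    multiplier_coef F eps (Lforall S) k * (multiplier_coef F eps L h)^*
    + (multiplier_coef F eps (Lforall S) k^-1%g)^* * multiplier_coef F eps L g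
    - (multiplier_coef F eps (Lforall S) k^-1%g)^* * multiplier_coef F eps (Lforall S) k.
  move=> adjF eps_le gh [a aF Lag] [b bF Lbh] LE; apply: (@cotlar_coefE R).
  have [|//|||E1 E2] := hcotlar F eps _ _ g h gh.
  - by move=> x /adjF; apply: adj_sphere1 => //; exact: Cay_irr.
  - by exists a.
  - by exists b.
  (* [E1] settles [L = Lforall S]; chaining it with [E2] settles [L = Lexists S]. *)
  - by case: LE => ->; rewrite E1// E2.
split=> //; apply: Cay_acyclic => //; first exact: unique_first_step cotlar.
exact: adj_dist_neq cotlar.
Qed.
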